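(* Let $\mathcal{A},\mathcal{C},r$ be the data of the constrained least-squares problem described in the context, with perturbations $\Delta\mathcal{A},\Delta\mathcal{C},\Delta r$ such that $\ker(\mathcal{C}+\Delta\mathcal{C})=\ker\mathcal{C}$; let $c$ be the solution of the unperturbed problem, $\tilde c$ the solution of the perturbed problem, and $\Delta c=c-\tilde c$. Let $\omega=\|(\mathcal{A}P)^+\|\,\|\Delta\mathcal{A}P\|<1$. Then \[ |\Delta c|\le\frac{\|(\mathcal{A}P)^+\|}{1-\omega}\left\{\|\Delta\mathcal{A}P\|\left[|c|+\|(\mathcal{A}P)^+\|\,|\mathfrak{r}|\right]+|\Delta r|\right\} \] and, if $c\ne0$, \[ \frac{|\Delta c|}{|c|}\le\frac{1}{1-\omega}\left\{\left[\kappa_{\mathcal{C}}(\mathcal{A})+\frac{|\mathfrak{r}|}{\|\mathcal{A}P\|\,|c|}\kappa_{\mathcal{C}}(\mathcal{A})^2\right]\frac{\|\Delta\mathcal{A}P\|}{\|\mathcal{A}P\|}+\frac{\|(\mathcal{A}P)^+\|\,|r|}{|c|}\cdot\frac{|\Delta r|}{|r|}\right\}, \] where $\mathfrak{r}=r-\mathcal{A}c$ and $\kappa_{\mathcal{C}}(\mathcal{A})=\|\mathcal{A}P\|\,\|(\mathcal{A}P)^+\|$.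
   Context: Discrete problem. Let $[a,b]$ be a compact interval, $k<m$ positive integers, $N\ge1$, $n\ge2$, $M\ge N+1$ integers, $a=t_0<\dots<t_n=b$ a partition, $h_j=t_j-t_{j-1}$. Given are the linear boundary value problem $A(t)(Dx)'(t)+B(t)x(t)=q(t)$, $G_ax(a)+G_bx(b)=d$, with $D=[I_k\ 0]\in\mathbb{R}^{k\times m}$, sufficiently smooth $A(t)\in\mathbb{R}^{m\times k}$, $B(t)\in\mathbb{R}^{m\times m}$, $q(t)\in\mathbb{R}^m$, and $G_a,G_b\in\mathbb{R}^{l\times m}$ ($l$ the dynamical degree of freedom of the equation), $\ker D\subseteq\ker G_a\cap\ker G_b$. Basis: $\{p_0,\dots,p_{N-1}\}$ is a basis of the polynomials of degree $\le N-1$ on $[0,1]$; $\bar p_0=1$, $\bar p_i(\tau)=\int_0^\tau p_{i-1}(\sigma)d\sigma$ ($i=1,\dots,N$); $p_{ji}(t)=p_i((t-t_{j-1})/h_j)$, $\bar p_{ji}(t)=h_j\bar p_i((t-t_{j-1})/h_j)$. A vector $c\in\mathbb{R}^{n(mN+k)}$ with entries $c_{j\kappa l}$ ($j=1,\dots,n$; $\kappa=1,\dots,m$; $l=0,\dots,N$ if $\kappa\le k$, $l=0,\dots,N-1$ if $\kappa>k$) represents the piecewise polynomial function with pieces $x_j=(x_{j1},\dots,x_{jm})^T$ on the $j$-th subinterval, $x_{j\kappa}=\sum_{l=0}^Nc_{j\kappa l}\bar p_{jl}$ ($\kappa\le k$), $x_{j\kappa}=\sum_{l=0}^{N-1}c_{j\kappa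 l}p_{jl}$ ($\kappa>k$). Constraint matrix: $\mathcal{C}\in\mathbb{R}^{k(n-1)\times n(mN+k)}$ is the matrix such that the entries of $\mathcal{C}c$ are the jumps $x_{j\kappa}(t_j)-x_{j+1,\kappa}(t_j)$, $j=1,\dots,n-1$ (outer index), $\kappa=1,\dots,k$ (inner index). It has full row rank. Least-squares matrix: given collocation points $0\le\rho_1<\dots<\rho_M\le1$, $t_{ji}=t_{j-1}+\rho_ih_j$, and a symmetric positive definite $L\in\mathbb{R}^{M\times M}$, let $w_j=A(Dx_j)'+Bx_j-q$ and let $W\in\mathbb{R}^{mMn}$ be the stacked vector of $W_j=h_j^{1/2}(w_j(t_{j1}),\dots,w_j(t_{jM}))$, $j=1,\dots,n$, and $\mathcal{L}=\mathrm{diag}(L\otimes I_m,\dots,L\otimes I_m)$. The matrix $\mathcal{A}\in\mathbb{R}^{(nmM+l)\times n(mN+k)}$ and $r\in\mathbb{R}^{nmM+l}$ are defined by the affine identity $\mathcal{A}c-r=\begin{bmatrix}\mathcal{L}^{1/2}W\\ G_ax_1(a)+G_bx_n(b)-d\end{bmatrix}$ for all $c$. Unperturbed problem: minimize $|\mathcal{A}c-r|^2$ subject to $\mathcal{C}c=0$. Perturbed problem: minimize $|(\mathcal{A}+\Delta\mathcal{A})z-(r+\Delta r)|$ subject to $(\mathcal{C}+\Delta\mathcal{C})z=0$, where $\Delta\mathcal{A},\Delta\mathcal{C},\Delta r$ have the same sizes as $\mathcal{A},\mathcal{C},r$. Notation: $|\cdot|$ is the Euclidean norm, $\|\cdot\|$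 the spectral norm, $\mathcal{M}^+$ the Moore–Penrose inverse. $P=I-\mathcal{C}^+\mathcal{C}$ is the orthogonal projector onto $\ker\mathcal{C}$; $\mathcal{D}$ is a matrix whose columns form an orthonormal basis of $\ker\mathcal{C}$. Standing assumption: $\mathcal{A}\mathcal{D}$ has full column rank. *)

(* Defs.v *)
From HB Require Import structures.
From mathcomp Require Import all_boot all_order all_algebra.
From mathcomp Require Import mxtens.
From mathcomp Require Import all_classical all_reals all_analysis.

Set Implicit Arguments.
Unset Strict Implicit.
Unset Printing Implicit Defensive.

Import Order.TTheory GRing.Theory Num.Theory.
Import numFieldNormedType.Exports.
Local Open Scope classical_set_scope.
Local Open Scope ring_scope.

Section MatrixNotions.
Context {R : realType}.

(* The library norm on matrices is the max norm. *)
Definition enorm {s} (x : 'cV[R]_s) : R := Num.sqrt (\sum_i x i 0 ^+ 2).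

Definition specnorm {s u} (X : 'M[R]_(s, u)) : R :=
  sup [set enorm (X *m x) | x in [set x : 'cV[R]_u | enorm x <= 1]].

Definition is_mpinv {s u} (X : 'M[R]_(s, u)) (Y : 'M[R]_(u, s)) : Prop :=
  [/\ X *m Y *m X = X, Y *m X *m Y = Y,
      (X *m Y)^T = X *m Y & (Y *m X)^T = Y *m X].

Definition mpinv {s u} (X : 'M[R]_(s, u)) : 'M[R]_(u, s) :=
  get [set Y | is_mpinv X Y].

Definition spd {s} (X : 'M[R]_s) : Prop :=
  X^T = X /\ forall x : 'cV[R]_s, x != 0 -> 0 < (x^T *m X *m x) 0 0.

Definition is_spd_sqrt {s} (X S : 'M[R]_s) : Prop := spd S /\ S *m S = X.

Definition same_ker {s u v} (X : 'M[R]_(s, u)) (Y : 'M[R]_(v, u)) : Prop :=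
  forall x : 'cV[R]_u, X *m x = 0 <-> Y *m x = 0.

Definition orthonormal_kerbasis {s u dim} (X : 'M[R]_(s, u))
    (D : 'M[R]_(u, dim)) : Prop :=
  D^T *m D = 1%:M /\
  forall x : 'cV[R]_u, X *m x = 0 <-> exists y : 'cV[R]_dim, x = D *m y.

Definition minimizes_on_ker {s u} (f : 'cV[R]_u -> R) (X : 'M[R]_(s, u))
    (z : 'cV[R]_u) : Prop :=
  X *m z = 0 /\ forall y : 'cV[R]_u, X *m y = 0 -> f z <= f y.

Lemma gram_unitmx {s u} (X : 'M[R]_(s, u)) :
  row_free X -> X *m X^T \in unitmx.
Proof.
move=> fX; rewrite -row_free_unit -kermx_eq0.
apply/eqP/row_matrixP => i; rewrite row0.
set v := row i _.
have v0 : v *m (X *m X^T) = 0 by rewrite /v -row_mul mulmx_ker row0.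
have w0 : (v *m X) *m (v *m X)^T = 0.
  by rewrite trmx_mul mulmxA -(mulmxA v) v0 mul0mx.
have /eqP : v *m X = 0.
  apply/rowP => j; rewrite [RHS]mxE.
  have /eqP := congr1 (fun Z : 'M[R]_1 => Z 0 0) w0.
  rewrite !mxE psumr_eq0 => [/allP/(_ j)|i0 _]; last first.
    by rewrite [_^T _ _]mxE -expr2 sqr_ge0.
  rewrite mem_index_enum => /(_ isT) /=.
  by rewrite [_^T _ _]mxE mulf_eq0 orbb !mxE => /eqP.
by rewrite mulmx_free_eq0// => /eqP.
Qed.

Lemma mpinvP {s u} (X : 'M[R]_(s, u)) : is_mpinv X (mpinv X).
Proof.
rewrite /mpinv; apply: (@getPex _ [set Y | is_mpinv X Y]).
have [rk [F [G [XFG uG uF]]]] : exists rk (F : 'M[R]_(s, rk)) (G : 'M[R]_(rk, u)),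
    [/\ F *m G = X, G *m G^T \in unitmx & F^T *m F \in unitmx].
  exists (\rank X), (col_base X), (row_base X); split.
  - by rewrite mulmx_base.
  - by apply: gram_unitmx; exact: row_base_free.
  - rewrite -{2}(trmxK (col_base X)); apply: gram_unitmx.
    by rewrite /row_free mxrank_tr; exact: col_base_full.
exists (G^T *m invmx (G *m G^T) *m invmx (F^T *m F) *m F^T).
set IG := invmx (G *m G^T); set IF := invmx (F^T *m F).
have sG : IG^T = IG by rewrite /IG trmx_inv trmx_mul trmxK.
have sF : IF^T = IF by rewrite /IF trmx_inv trmx_mul trmxK.
have XY : X *m (G^T *m IG *m IF *m F^T) = F *m IF *m F^T.
  by rewrite -XFG !mulmxA -(mulmxA F G) -(mulmxA F (G *m _)) mulmxV// mulmx1.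
have YX : (G^T *m IG *m IF *m F^T) *m X = G^T *m IG *m G.
  rewrite -XFG !mulmxA -(mulmxA _ F^T F) -(mulmxA _ IF (F^T *m F)).
  by rewrite mulVmx// mulmx1.
split.
- by rewrite XY -XFG mulmxA -(mulmxA _ F^T F) -(mulmxA F IF) mulVmx// mulmx1.
- by rewrite YX !mulmxA -(mulmxA _ G G^T) -(mulmxA _ IG (G *m _)) mulVmx// mulmx1.
- by rewrite XY !trmx_mul sF trmxK mulmxA.
- by rewrite YX !trmx_mul sG trmxK mulmxA.
Qed.

End MatrixNotions.

Section Discretization.
Context {R : realType}.
Variables (k m N n M l : nat).

Definition polyint (p : {poly R}) : {poly R} :=
  'X * \poly_(i < size p) (p`_i / i.+1%:R).

Lemma deriv_polyint p : (polyint p)^`() = p.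
Proof.
apply/polyP => i; rewrite coef_deriv coefXM /= coef_poly.
case: ltnP => [_|si]; last by rewrite mul0rn nth_default.
by rewrite -[LHS]mulr_natr divfK // pnatr_eq0.
Qed.

Lemma polyintE p (x : R) : 0 <= x ->
  (polyint p).[x] = (\int[@lebesgue_measure R]_(s in `[0, x]) p.[s])%R.
Proof.
rewrite le_eqVlt => /predU1P[<-|x0].
  by rewrite set_itv1 Rintegral_set1 hornerM hornerX mul0r.
have cont (g : {poly R}) : continuous (horner g) by exact: continuous_horner.
rewrite /Rintegral (@continuous_FTC2 _ _ (horner (polyint p)) 0 x)//.
- by rewrite /= [X in _ - X]hornerM hornerX mul0r subr0.
- by apply: continuous_subspaceT; exact: cont.
- split=> [y _||]; first exact: derivable_horner.
    by apply: cvg_at_right_filter; exact: cont.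
  by apply: cvg_at_left_filter; exact: cont.
- by move=> y _; rewrite -derivE deriv_polyint.
Qed.

Variables (t : nat -> R) (p : N.-tuple {poly_N R}).

(* Subintervals are numbered from 0: the j-th one is [t j, t j.+1]. *)
Definition step (j : nat) : R := t j.+1 - t j.

Definition to_ref (j : nat) : {poly R} := (step j)^-1 *: ('X - (t j)%:P).

Definition pbar (i : nat) : {poly R} :=
  if i is i'.+1 then polyint p`_i' else 1.

Definition ploc (j i : nat) : {poly R} := (p`_i : {poly R}) \Po to_ref j.
Definition pbarloc (j i : nat) : {poly R} := step j *: (pbar i \Po to_ref j).

(* The entries c_{j kappa i} are listed lexicographically in (j, kappa, i), all
   indices from 0; within block j, kappa * N + minn kappa k entries belong to the
   components before kappa. The default value 0 is never reached for
   j < n, kappa < m and i < N + (kappa < k). *)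
Definition coef (c : 'cV[R]_(n * (m * N + k))) (j kappa i : nat) : R :=
  oapp (fun s => c s 0) 0
    (insub (j * (m * N + k) + (kappa * N + minn kappa k) + i)%N).

Definition piece (c : 'cV[R]_(n * (m * N + k))) (j : nat) : 'cV[{poly R}]_m :=
  \col_(kappa < m)
    if (kappa < k)%N then \sum_(i < N.+1) coef c j kappa i *: pbarloc j i
    else \sum_(i < N) coef c j kappa i *: ploc j i.

Definition eval {s} (x : 'cV[{poly R}]_s) (y : R) : 'cV[R]_s :=
  map_mx (fun g => g.[y]) x.

(* Row index (j, kappa) with j outer: the node between the pieces j and j.+1 is
   t j.+1. Here and below pid_mx k : 'M_(k, m) is D = [I_k 0]. *)
Definition jumps (c : 'cV[R]_(n * (m * N + k))) : 'cV[R]_(n.-1 * k) :=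
  \col_s let: (j, kappa) := mxtens_unindex s in
    let y := t j.+1 in
    (pid_mx k *m eval (piece c j) y - pid_mx k *m eval (piece c j.+1) y)
      kappa 0.

Variables (A : R -> 'M[R]_(m, k)) (B : R -> 'M[R]_m) (q : R -> 'cV[R]_m).
Variables (Ga Gb : 'M[R]_(l, m)) (d : 'cV[R]_l).
Variables (rho : 'I_M -> R).

Definition defect (x : 'cV[{poly R}]_m) (y : R) : 'cV[R]_m :=
  A y *m eval (map_mx (@deriv R) (pid_mx k *m x)) y + B y *m eval x y - q y.

Definition Wblock (c : 'cV[R]_(n * (m * N + k))) (j : nat) : 'cV[R]_(M * m) :=
  Num.sqrt (step j) *:
  \col_s let: (i, kappa) := mxtens_unindex s in
    defect (piece c j) (t j + rho i * step j) kappa 0.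

Definition Wvec (c : 'cV[R]_(n * (m * N + k))) :
    'cV[R]_(\sum_(j < n) (M * m)%N) :=
  \mxcol_(j < n) Wblock c j.

Definition bcdefect (c : 'cV[R]_(n * (m * N + k))) : 'cV[R]_l :=
  Ga *m eval (piece c 0) (t 0) + Gb *m eval (piece c n.-1) (t n) - d.

Definition weight (L : 'M[R]_M) : 'M[R]_(\sum_(j < n) (M * m)%N) :=
  \mxdiag_(j < n) (L *t (1%:M : 'M[R]_m)).

End Discretization.

(* Main.v *)
(** Write [X = A P], [al = |X^+|] and [g = (A + dA) (ct - c)]. On
    [ker C] one has [X^+ X = P = 1], hence [|y| <= al |A y|] there, which gives
    [(1 - omega) |ct - c| <= al |g|]. Subtracting the normal equations yields
    [<g, g> = <g, res + dr - dA c>]. The residual is orthogonal to [A (ker C)], and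
    the gap between [A (ker C)] and [(A + dA) (ker C)], two spaces of the same
    dimension, is at most [omega]; hence [<g, res> <= omega |g| |res|]. *)
Require Import Defs.
From HB Require Import structures.
From mathcomp Require Import all_boot all_order all_algebra.
From mathcomp Require Import mxtens.
From mathcomp Require Import all_classical all_reals all_analysis.
From mathcomp Require Import ring lra.
Set Implicit Arguments.
Unset Strict Implicit.
Unset Printing Implicit Defensive.
Import Order.TTheory GRing.Theory Num.Theory.
Import numFieldNormedType.Exports.
Local Open Scope classical_set_scope.
Local Open Scope ring_scope.


(** * Euclidean inner product, Euclidean norm and spectral norm *)

Section EuclideanNorm.
Context {R : realType}.

Definition dot {s} (x y : 'cV[R]_s) : R := (x^T *m y) 0 0.

Lemma dotC {s} (x y : 'cV[R]_s) : dot x y = dot y x.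
Proof. by rewrite /dot -[x^T *m y]trmxK trmx_mul trmxK mxE. Qed.

Lemma dotDl {s} (x y z : 'cV[R]_s) : dot (x + y) z = dot x z + dot y z.
Proof. by rewrite /dot linearD mulmxDl mxE. Qed.

Lemma dotZl {s} a (x y : 'cV[R]_s) : dot (a *: x) y = a * dot x y.
Proof. by rewrite /dot linearZ -scalemxAl mxE. Qed.

Lemma dotDr {s} (x y z : 'cV[R]_s) : dot x (y + z) = dot x y + dot x z.
Proof. by rewrite dotC dotDl !(dotC x). Qed.

Lemma dotZr {s} a (x y : 'cV[R]_s) : dot x (a *: y) = a * dot x y.
Proof. by rewrite dotC dotZl (dotC x). Qed.

Lemma dotNr {s} (x y : 'cV[R]_s) : dot x (- y) = - dot x y.
Proof. by rewrite -scaleN1r dotZr mulN1r. Qed.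

Lemma dotNl {s} (x y : 'cV[R]_s) : dot (- x) y = - dot x y.
Proof. by rewrite dotC dotNr (dotC x). Qed.

Definition dotE := (@dotDl, @dotDr, @dotNl, @dotNr, @dotZl, @dotZr).

Lemma dot_trmx {s u} (X : 'M[R]_(s, u)) x y :
  dot (X *m x) y = dot x (X^T *m y).
Proof. by rewrite /dot trmx_mul mulmxA. Qed.

Lemma dotxx {s} (x : 'cV[R]_s) : dot x x = \sum_i x i 0 ^+ 2.
Proof. by rewrite /dot mxE; apply: eq_bigr => i _; rewrite mxE. Qed.

Lemma dotxx_ge0 {s} (x : 'cV[R]_s) : 0 <= dot x x.
Proof. by rewrite dotxx sumr_ge0// => i _; rewrite sqr_ge0. Qed.

Lemma dotxx_eq0 {s} (x : 'cV[R]_s) : (dot x x == 0) = (x == 0).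
Proof.
apply/eqP/eqP => [|->]; last by rewrite /dot mulmx0 mxE.
rewrite dotxx => /psumr_eq0P x0; apply/colP => i; rewrite mxE.
by apply/eqP; rewrite -sqrf_eq0 x0// => j _; rewrite sqr_ge0.
Qed.

Lemma enorm_sqr {s} (x : 'cV[R]_s) : enorm x ^+ 2 = dot x x.
Proof. by rewrite dotxx sqr_sqrtr// -dotxx dotxx_ge0. Qed.

Lemma enorm_ge0 {s} (x : 'cV[R]_s) : 0 <= enorm x.
Proof. exact: sqrtr_ge0. Qed.
#[local] Hint Resolve enorm_ge0 : core.

Lemma enorm_eq0 {s} (x : 'cV[R]_s) : (enorm x == 0) = (x == 0).
Proof. by rewrite -sqrf_eq0 enorm_sqr dotxx_eq0. Qed.

Lemma enorm0 s : enorm (0 : 'cV[R]_s) = 0.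
Proof. by apply/eqP; rewrite enorm_eq0. Qed.

Lemma enormN {s} (x : 'cV[R]_s) : enorm (- x) = enorm x.
Proof. by rewrite /enorm; under eq_bigr do rewrite mxE sqrrN. Qed.

Lemma enormZ {s} a (x : 'cV[R]_s) : enorm (a *: x) = `|a| * enorm x.
Proof.
apply/eqP; rewrite -(@eqrXn2 _ 2)// ?mulr_ge0//.
by rewrite exprMn !enorm_sqr real_normK ?num_real// !dotE mulrA.
Qed.

Lemma dot_le {s} (x y : 'cV[R]_s) : dot x y <= enorm x * enorm y.
Proof.
have [->|y0] := eqVneq y 0; first by rewrite /dot mulmx0 mxE mulr_ge0.
have [->|x0] := eqVneq x 0; first by rewrite /dot trmx0 mul0mx mxE mulr_ge0.
have nx : 0 < enorm x by rewrite lt_neqAle eq_sym enorm_eq0 x0 enorm_ge0.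
have ny : 0 < enorm y by rewrite lt_neqAle eq_sym enorm_eq0 y0 enorm_ge0.
(* This square expands to [2 |x| |y| (|x| |y| - <x, y>)], which gives Cauchy-Schwarz. *)
have := dotxx_ge0 (enorm y *: x - enorm x *: y).
rewrite !dotE (dotC y x) -!enorm_sqr => h.
have {}h : 0 <= (enorm x * enorm y) * (enorm x * enorm y - dot x y) by lra.
by rewrite pmulr_rge0 ?mulr_gt0// subr_ge0 in h.
Qed.

Lemma dot_norm_le {s} (x y : 'cV[R]_s) : `|dot x y| <= enorm x * enorm y.
Proof. by rewrite ler_norml dot_le andbT lerNl
  -dotNl (le_trans (dot_le _ _))// enormN. Qed.

Lemma ler_enormD {s} (x y : 'cV[R]_s) : enorm (x + y) <= enorm x + enorm y.
Proof.
rewrite -(@ler_pXn2r _ 2)// ?nnegrE ?addr_ge0// sqrrD !enorm_sqr !dotE (dotC y x).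
have := dot_le x y; lra.
Qed.

(** The best step [h = - <f, e> / <f, f>] lowers [|e|^2] by [<f, e>^2 / <f, f>], so minimality at
    [h = 0] forces this amount to vanish. *)
Lemma least_dist_orthogonal {s} (e f : 'cV[R]_s) :
  (forall h : R, enorm e <= enorm (e + h *: f)) -> dot f e = 0.
Proof.
move=> he; have [->|f0] := eqVneq f 0; first by rewrite /dot trmx0 mul0mx mxE.
have ff : 0 < dot f f by rewrite lt_neqAle eq_sym dotxx_eq0 f0 dotxx_ge0.
have := he (- (dot f e / dot f f)).
rewrite -(@ler_pXn2r _ 2)// ?nnegrE// !enorm_sqr !dotE (dotC e f).
set g := dot f e; set h := dot f f in ff *.
have hn : h != 0 by rewrite gt_eqF.
have -> : dot e e + - (g / h) * g + (- (g / h) * g + - (g / h) * (- (g / h) * h))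
  = dot e e - g ^+ 2 / h by field.
rewrite -subr_ge0 addrAC subrr add0r oppr_ge0 pmulr_lle0 ?invr_gt0// => g2.
by apply/eqP; rewrite -sqrf_eq0 eq_le g2 sqr_ge0.
Qed.

(** Cauchy-Schwarz row by row; the constant is the Frobenius norm. It bounds the set whose [sup]
    defines [specnorm], so that this [sup] is a genuine supremum. *)
Lemma enorm_row_mul_le {s u} (X : 'M[R]_(s, u)) x :
  enorm (X *m x) <= Num.sqrt (\sum_i dot (row i X)^T (row i X)^T) * enorm x.
Proof.
rewrite -(@ler_pXn2r _ 2)// ?nnegrE ?mulr_ge0 ?sqrtr_ge0//.
rewrite exprMn !enorm_sqr sqr_sqrtr; last first.
  by apply: sumr_ge0 => i _; exact: dotxx_ge0.
rewrite {1}dotxx mulr_suml; apply: ler_sum => i _.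
have -> : (X *m x) i 0 = dot (row i X)^T x.
  by rewrite /dot trmxK -row_mul [RHS]mxE.
rewrite -!enorm_sqr -exprMn -real_normK ?num_real//.
by rewrite ler_pXn2r ?nnegrE ?mulr_ge0// dot_norm_le.
Qed.

Lemma specnorm_has_sup {s u} (X : 'M[R]_(s, u)) :
  has_sup [set enorm (X *m x) | x in [set x : 'cV[R]_u | enorm x <= 1]].
Proof.
split; first by exists (enorm (X *m 0)); exists 0; rewrite //= enorm0.
exists (Num.sqrt (\sum_i dot (row i X)^T (row i X)^T)) => _ [x /= x1 <-].
by rewrite (le_trans (enorm_row_mul_le X x))// ler_piMr// sqrtr_ge0.
Qed.

Lemma specnorm_ge0 {s u} (X : 'M[R]_(s, u)) : 0 <= specnorm X.
Proof.
apply: (le_trans (enorm_ge0 (X *m 0))).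
apply: sup_upper_bound; first exact: specnorm_has_sup.
by exists 0; rewrite //= enorm0.
Qed.

Lemma enorm_mulmx_le {s u} (X : 'M[R]_(s, u)) x :
  enorm (X *m x) <= specnorm X * enorm x.
Proof.
have [->|x0] := eqVneq x 0; first by rewrite mulmx0 !enorm0 mulr0.
have nx : 0 < enorm x by rewrite lt_neqAle eq_sym enorm_eq0 x0 enorm_ge0.
rewrite -ler_pdivrMr//; apply: sup_upper_bound; first exact: specnorm_has_sup.
exists ((enorm x)^-1 *: x) => /=.
  by rewrite enormZ ger0_norm ?invr_ge0// mulVf// gt_eqF.
by rewrite -scalemxAr enormZ ger0_norm ?invr_ge0// mulrC.
Qed.

End EuclideanNorm.
#[local] Hint Extern 0 (is_true (0 <= _)) => solve [exact: enorm_ge0] : core.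
#[local] Hint Extern 0 (is_true (0 <= _)) => solve [exact: specnorm_ge0] : core.

(* The two images have the same dimension, so [G v] is the orthogonal projection
   onto [im G] of some [F y]. The distance from [G v] to its nearest multiple of
   [F y] is at most [omega |G v|], whereas comparing [G v] with [F v] would only
   give [omega / (1 - omega)]. *)
Lemma dot_perturbed_image_le {R : realType} {s dim} (F G : 'M[R]_(s, dim))
    (omega : R) (v : 'cV[R]_dim) (e : 'cV[R]_s) :
    (forall y : 'cV[R]_dim, F *m y = 0 -> y = 0) -> omega < 1 ->
    (forall y : 'cV[R]_dim, enorm (F *m y - G *m y) <= omega * enorm (F *m y)) ->
    (forall y : 'cV[R]_dim, dot (F *m y) e = 0) ->
  dot (G *m v) e <= omega * enorm (G *m v) * enorm e.
Proof.
move=> Finj om1 FG Fe.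
(* If [F y] is orthogonal to [im G], then [|F y|^2 = <F y - G y, F y> <= omega |F y|^2], impossible
   for [omega < 1] unless [F y = 0]. *)
have GFinj (y : 'cV[R]_dim) : G^T *m F *m y = 0 -> y = 0.
  move=> y0; apply: Finj; apply/eqP; rewrite -enorm_eq0; apply/negP => /negP nF.
  have F0 : 0 < enorm (F *m y) by rewrite lt_neqAle eq_sym nF enorm_ge0.
  have GF : dot (G *m y) (F *m y) = 0.
    by rewrite dot_trmx mulmxA y0 /dot mulmx0 mxE.
  have := dot_le (F *m y - G *m y) (F *m y); rewrite !dotE GF subr0 -enorm_sqr.
  rewrite expr2 ler_pM2r// => /le_trans/(_ (FG y)).
  by rewrite -subr_ge0 -[X in _ - X]mul1r -mulrBl pmulr_lge0// subr_ge0 leNgt om1.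
have uGF : G^T *m F \in unitmx.
  rewrite -unitmx_tr -row_free_unit; apply: inj_row_free => y y0.
  have /GFinj : G^T *m F *m y^T = 0.
    by rewrite -(trmxK (G^T *m F)) -trmx_mul y0 trmx0.
  by move/(congr1 trmx); rewrite trmxK trmx0.
(* Solves [G^T (F y - G v) = 0]: [w - g] is orthogonal to [im G]. *)
pose y := invmx (G^T *m F) *m (G^T *m (G *m v)).
set g := G *m v; set w := F *m y.
have Gw z : dot (G *m z) (w - g) = 0.
  rewrite dot_trmx mulmxBr (mulmxA G^T F y) /y [G^T *m F *m _]mulmxA mulmxV//.
  by rewrite mul1mx subrr /dot mulmx0 mxE.
have gw : dot g w = dot g g.
  by have := Gw v; rewrite -/g !dotE => /eqP; rewrite subr_eq0 => /eqP.
have wg : enorm (w - g) ^+ 2 = enorm w ^+ 2 - enorm g ^+ 2.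
  by rewrite !enorm_sqr !dotE (dotC w g) gw; ring.
(* By that orthogonality [|w - g|^2 = <w - G y, w - g>], and [|w - G y| <= omega |w|] by
   assumption. *)
have wg_le : enorm (w - g) <= omega * enorm w.
  have [->|wg0] := eqVneq (enorm (w - g)) 0.
    exact: (le_trans (enorm_ge0 _) (FG y)).
  have {}wg0 : 0 < enorm (w - g) by rewrite lt_neqAle eq_sym wg0 enorm_ge0.
  rewrite -(ler_pM2l wg0) (le_trans _ (ler_wpM2l (ltW wg0) (FG y)))//.
  rewrite -expr2 enorm_sqr (le_trans _ (dot_le _ _))//.
  rewrite !(dotC (w - g)).
  have := Gw v; have := Gw y; rewrite -/g -/w !dotE; lra.
have [w0|w0] := eqVneq w 0.
  have : dot g g == 0 by rewrite -gw w0 /dot mulmx0 mxE.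
  by rewrite dotxx_eq0 => /eqP ->; rewrite enorm0 mulr0 mul0r /dot trmx0 mul0mx mxE.
have nw : 0 < enorm w by rewrite lt_neqAle eq_sym enorm_eq0 w0 enorm_ge0.
have w2 : 0 < enorm w ^+ 2 by rewrite exprn_gt0.
rewrite -(ler_pM2l w2).
(* As [<w, e> = 0], any multiple of [w] may be subtracted from [g]; the nearest one is
   [(|g|^2 / |w|^2) w], here with the denominator cleared. *)
have -> : enorm w ^+ 2 * dot g e
    = dot (enorm w ^+ 2 *: g - enorm g ^+ 2 *: w) e.
  by rewrite !dotE Fe mulr0 subr0.
apply: (le_trans (dot_le _ _)); rewrite !mulrA ler_wpM2r//.
have -> : enorm (enorm w ^+ 2 *: g - enorm g ^+ 2 *: w)
    = enorm w * enorm g * enorm (w - g).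
  apply/eqP; rewrite -(@eqrXn2 _ 2)// ?mulr_ge0//.
  rewrite !exprMn wg !enorm_sqr !dotE (dotC w g) gw; apply/eqP; ring.
rewrite (le_trans (ler_wpM2l _ wg_le)) ?mulr_ge0// le_eqVlt; apply/orP; left.
by apply/eqP; ring.
Qed.

(** * The orthogonal projector onto [ker C] and the pseudoinverse of [X P] *)

Section KernelProjector.
Context {R : realType} {s u v : nat}.
Variables (C : 'M[R]_(v, u)) (X : 'M[R]_(s, u)).
Let P := 1%:M - mpinv C *m C.

Lemma kerproj_id (x : 'cV[R]_u) : C *m x = 0 -> P *m x = x.
Proof. by move=> Cx; rewrite mulmxBl mul1mx -mulmxA Cx mulmx0 subr0. Qed.

Lemma mulmx_kerproj : C *m P = 0.
Proof.
by have [CYC _ _ _] := mpinvP C; rewrite mulmxBr mulmx1 mulmxA CYC subrr.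
Qed.

Lemma tr_kerproj : P^T = P.
Proof.
by have [_ _ _ sYC] := mpinvP C; rewrite linearB /= trmx1 sYC.
Qed.

(** With [Z = (X P)^+], both [x] and [Z X x] lie in [ker C] and have the same image under [X],
    because [X P Z X P = X P]; injectivity on [ker C] identifies them. *)
Lemma mpinv_mul_kerproj (x : 'cV[R]_u) :
    (forall y : 'cV[R]_u, C *m y = 0 -> X *m y = 0 -> y = 0) -> C *m x = 0 ->
  mpinv (X *m P) *m (X *m x) = x.
Proof.
move=> Xinj Cx; have [XZX _ _ sZX] := mpinvP (X *m P).
set Z := mpinv _ in XZX sZX *.
(* [Z X P] is symmetric, so its transpose starts with [P], which [C] annihilates. *)
have CZX : C *m (Z *m (X *m P)) = 0.
  by rewrite -sZX !trmx_mul tr_kerproj !mulmxA mulmx_kerproj !mul0mx.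
have -> : X *m x = X *m P *m x by rewrite -mulmxA kerproj_id.
have Cd : C *m (Z *m (X *m P *m x) - x) = 0.
  by rewrite mulmxBr Cx subr0 (mulmxA Z) (mulmxA C) CZX mul0mx.
apply/eqP; rewrite -subr_eq0; apply/eqP/Xinj => //.
rewrite -(kerproj_id Cd) (mulmxA X) mulmxBr (mulmxA (X *m P) Z).
by rewrite (mulmxA _ (X *m P) x) XZX subrr.
Qed.

End KernelProjector.

(** * Normal equations and injectivity on the constraint kernel *)

Lemma minimizes_normal_eq {R : realType} {s u v} (X : 'M[R]_(s, u)) (b : 'cV[R]_s)
    (C : 'M[R]_(v, u)) (z y : 'cV[R]_u) :
    minimizes_on_ker (fun x => enorm (X *m x - b)) C z -> C *m y = 0 ->
  dot (X *m y) (X *m z - b) = 0.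
Proof.
move=> [Cz min] Cy; apply: least_dist_orthogonal => h.
have -> : X *m z - b + h *: (X *m y) = X *m (z + h *: y) - b.
  by rewrite mulmxDr -scalemxAr addrAC.
by apply: min; rewrite mulmxDr -scalemxAr Cz Cy scaler0 addr0.
Qed.

Lemma full_col_rank_inj {R : realType} {s dim} (X : 'M[R]_(s, dim))
    (y : 'cV[R]_dim) :
  \rank X = dim -> X *m y = 0 -> y = 0.
Proof.
move=> hX y0; have fX : row_free X^T by rewrite /row_free mxrank_tr hX.
apply: trmx_inj; apply: (row_free_inj fX).
by rewrite trmx0 mul0mx -trmx_mul y0 trmx0.
Qed.

Lemma full_col_rank_inj_ker {R : realType} {s u v dim} (X : 'M[R]_(s, u))
    (C : 'M[R]_(v, u)) (D : 'M[R]_(u, dim)) (y : 'cV[R]_u) :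
    orthonormal_kerbasis C D -> \rank (X *m D) = dim ->
  C *m y = 0 -> X *m y = 0 -> y = 0.
Proof.
move=> [_ hD] hXD /hD[z ->].
by rewrite mulmxA => /(full_col_rank_inj hXD) ->; rewrite mulmx0.
Qed.

(** The perturbed constraint enters only through its kernel, so both problems minimize over the same
    subspace and [ct - c] is an admissible direction in both normal equations. *)
Lemma constrained_lsq_perturbation {R : realType} {s u v w dim : nat}
    (X dX : 'M[R]_(s, u)) (C : 'M[R]_(v, u)) (C' : 'M[R]_(w, u))
    (D : 'M[R]_(u, dim)) (b db : 'cV[R]_s) (c ct : 'cV[R]_u) :
    orthonormal_kerbasis C D -> \rank (X *m D) = dim -> same_ker C' C ->
    minimizes_on_ker (fun z => enorm (X *m z - b)) C c ->
    minimizes_on_ker (fun z => enorm ((X + dX) *m z - (b + db))) C' ct ->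
  let P := 1%:M - mpinv C *m C in
  let al := specnorm (mpinv (X *m P)) in
  let eps := specnorm (dX *m P) in
  al * eps < 1 ->
  (1 - al * eps) * enorm (c - ct) <=
    al * (eps * (enorm c + al * enorm (b - X *m c)) + enorm db).
Proof.
move=> hD hXD hC minc minct P al eps om1.
have Xinj := fun y => @full_col_rank_inj_ker _ _ _ _ _ X C D y hD hXD.
have [_ kerD] := hD.
have al0 : 0 <= al by exact: specnorm_ge0.
have eps0 : 0 <= eps by exact: specnorm_ge0.
have le_al (y : 'cV[R]_u) : C *m y = 0 -> enorm y <= al * enorm (X *m y).
  by move=> Cy; rewrite -{1}(mpinv_mul_kerproj Xinj Cy) enorm_mulmx_le.
have le_eps (y : 'cV[R]_u) : C *m y = 0 -> enorm (dX *m y) <= eps * enorm y.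
  by move=> Cy; rewrite -{1}(kerproj_id Cy) mulmxA enorm_mulmx_le.
have CD (y : 'cV[R]_dim) : C *m (D *m y) = 0 by apply/kerD; exists y.
have Cc : C *m c = 0 by case: minc.
have Cct : C *m ct = 0 by apply/hC; case: minct.
pose y := ct - c.
have Cy : C *m y = 0 by rewrite mulmxBr Cc Cct subrr.
set g := (X + dX) *m y; set e := b - X *m c.
have ge : dot g e <= al * eps * enorm g * enorm e.
  have /kerD[z yz] := Cy.
  (* Here [G = (X + dX) D]. Since [D x] lies in [ker C],
     [|dX D x| <= eps |D x| <= al eps |X D x|]. *)
  rewrite /g yz mulmxA; apply: (dot_perturbed_image_le (F := X *m D)) => // [x||].
  - exact: full_col_rank_inj.
  - move=> x; rewrite -mulmxBl -mulmxBl opprD addNKr mulNmx mulNmx enormN.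
    rewrite -!mulmxA (le_trans (le_eps _ (CD x)))// (mulrC al) -mulrA.
    by rewrite ler_wpM2l// le_al.
  - move=> x; have -> : e = - (X *m c - b) by rewrite opprB.
    by rewrite -mulmxA dotNr (minimizes_normal_eq minc) ?oppr0.
(* The perturbed normal equation tested with [y]; its residual equals [g + dX c - e - db]. *)
have gg : dot g g = dot g e + dot g db - dot g (dX *m c).
  have /(minimizes_normal_eq minct) : C' *m y = 0 by exact/hC.
  have -> : (X + dX) *m ct - (b + db) = g + dX *m c - e - db.
    rewrite /g /e /y mulmxBr !mulmxDl; apply/colP => i; rewrite !mxE; ring.
  rewrite -/g !dotE; lra.
have le_g : enorm g <= al * eps * enorm e + enorm db + eps * enorm c.
  have [->|g0] := eqVneq (enorm g) 0; first by rewrite !addr_ge0 ?mulr_ge0.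
  have {}g0 : 0 < enorm g by rewrite lt_neqAle eq_sym g0 enorm_ge0.
  rewrite -(ler_pM2l g0) -expr2 enorm_sqr gg.
  have := dot_le g db; have := dot_le g (- (dX *m c)); rewrite dotNr enormN.
  have := ler_wpM2l (enorm_ge0 g) (le_eps _ Cc); lra.
(* From [X y = g - dX y] follows [|y| <= al (|g| + eps |y|)]; the last term is absorbed on the
   left. *)
have le_y : (1 - al * eps) * enorm y <= al * enorm g.
  have Xg : enorm (X *m y) <= enorm g + eps * enorm y.
    have -> : X *m y = g - dX *m y by rewrite /g mulmxDl addrK.
    by rewrite (le_trans (ler_enormD _ _))// enormN lerD2l le_eps.
  have := le_al _ Cy; have := ler_wpM2l al0 Xg; lra.
rewrite -enormN opprB (le_trans le_y)//.
have := ler_wpM2l al0 le_g; lra.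
Qed.

(** * Absolute and relative error bounds for the discrete problem *)

Theorem theorem4 (R : realType) (k m N n M l : nat)
  (hk : (0 < k)%N) (hkm : (k < m)%N) (hN : (1 <= N)%N) (hn : (2 <= n)%N)
  (hM : (N.+1 <= M)%N)
  (a b : R) (t : nat -> R) (ha : t 0%N = a) (hb : t n = b)
  (ht : forall j : nat, (j < n)%N -> t j < t j.+1)
  (A : R -> 'M[R]_(m, k)) (B : R -> 'M[R]_m) (q : R -> 'cV[R]_m)
  (hA : forall i j, {within `[a, b], continuous (fun s => A s i j)})
  (hB : forall i j, {within `[a, b], continuous (fun s => B s i j)})
  (hq : forall i, {within `[a, b], continuous (fun s => q s i 0)})
  (Ga Gb : 'M[R]_(l, m)) (d : 'cV[R]_l)
  (hG : forall v : 'cV[R]_m, (pid_mx k : 'M[R]_(k, m)) *m v = 0 ->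
     Ga *m v = 0 /\ Gb *m v = 0)
  (p : N.-tuple {poly_N R}) (hp : basis_of fullv p)
  (rho : 'I_M -> R) (hrho01 : forall i, 0 <= rho i <= 1)
  (hrho : forall i j : 'I_M, (i < j)%N -> rho i < rho j)
  (L : 'M[R]_M) (hL : spd L)
  (Lh : 'M[R]_(\sum_(j < n) (M * m)%N)) (hLh : is_spd_sqrt (weight m n L) Lh)
  (Cm : 'M[R]_(n.-1 * k, n * (m * N + k)))
  (hC : forall c, Cm *m c = jumps t p c)
  (Am : 'M[R]_(\sum_(j < n) (M * m)%N + l, n * (m * N + k)))
  (r : 'cV[R]_(\sum_(j < n) (M * m)%N + l))
  (hAm : forall c, Am *m c - r =
     col_mx (Lh *m Wvec t p A B q rho c) (bcdefect t p Ga Gb d c))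
  (dim : nat) (Dm : 'M[R]_(n * (m * N + k), dim))
  (hD : orthonormal_kerbasis Cm Dm) (hAD : \rank (Am *m Dm) = dim)
  (dA : 'M[R]_(\sum_(j < n) (M * m)%N + l, n * (m * N + k)))
  (dC : 'M[R]_(n.-1 * k, n * (m * N + k)))
  (dr : 'cV[R]_(\sum_(j < n) (M * m)%N + l))
  (hker : same_ker (Cm + dC) Cm)
  (c ct : 'cV[R]_(n * (m * N + k)))
  (hc : minimizes_on_ker (fun z => enorm (Am *m z - r) ^+ 2) Cm c)
  (hct : minimizes_on_ker
     (fun z => enorm ((Am + dA) *m z - (r + dr))) (Cm + dC) ct) :
  let P := 1%:M - mpinv Cm *m Cm in
  let deltac := c - ct in
  let omega := specnorm (mpinv (Am *m P)) * specnorm (dA *m P) in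
  let res := r - Am *m c in
  let kappa := specnorm (Am *m P) * specnorm (mpinv (Am *m P)) in
  omega < 1 ->
  enorm deltac <=
    specnorm (mpinv (Am *m P)) / (1 - omega) *
    (specnorm (dA *m P) *
       (enorm c + specnorm (mpinv (Am *m P)) * enorm res) + enorm dr)
  /\
  (c != 0 ->
   enorm deltac / enorm c <=
     1 / (1 - omega) *
     ((kappa + enorm res / (specnorm (Am *m P) * enorm c) * kappa ^+ 2) *
        (specnorm (dA *m P) / specnorm (Am *m P))
      + specnorm (mpinv (Am *m P)) * enorm r / enorm c * (enorm dr / enorm r))).
Proof.
move=> P deltac omega res kappa om1.
have hc' : minimizes_on_ker (fun z => enorm (Am *m z - r)) Cm c.
  case: hc => Cc min; split => // y /min.
  by rewrite ler_pXn2r ?nnegrE.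
have main := constrained_lsq_perturbation hD hAD hker hc' hct om1.
have om1' : 0 < 1 - omega by rewrite subr_gt0.
have bound : enorm deltac <=
    specnorm (mpinv (Am *m P)) / (1 - omega) *
    (specnorm (dA *m P) *
       (enorm c + specnorm (mpinv (Am *m P)) * enorm res) + enorm dr).
  by rewrite mulrAC ler_pdivlMr// mulrC.
split=> // c0.
have Cc : Cm *m c = 0 by case: hc.
have Acn0 (e : Am *m c = 0) : False.
  by move: c0; rewrite (full_col_rank_inj_ker hD hAD Cc e) eqxx.
(* If [r = 0], the competitor [0] attains the value [0], forcing [Am c = 0]. *)
have r0 : enorm r != 0.
  rewrite enorm_eq0; apply/eqP => r0; apply: Acn0; apply/eqP.
  rewrite -enorm_eq0 eq_le enorm_ge0 andbT.
  have [_ /(_ 0)] := hc'; rewrite !mulmx0 r0 !subr0 enorm0; exact.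
(* [Am c = Am P c] since [c] lies in the kernel, so a zero norm would again force [Am c = 0]. *)
have AP0 : specnorm (Am *m P) != 0.
  apply/eqP => AP0; apply: Acn0; apply/eqP.
  rewrite -enorm_eq0 eq_le enorm_ge0 andbT -[X in _ *m X](kerproj_id Cc) mulmxA.
  by rewrite (le_trans (enorm_mulmx_le _ _))// AP0 mul0r.
have nc0 : enorm c != 0 by rewrite enorm_eq0.
have nc : 0 < enorm c by rewrite lt_neqAle eq_sym nc0 enorm_ge0.
(* The relative bound is exactly the absolute one divided by [|c|]: the factors [|Am P|] and [|r|]
   cancel, being nonzero. *)
rewrite ler_pdivrMr// (le_trans bound)// le_eqVlt; apply/orP; left; apply/eqP.
rewrite /kappa; field.
by rewrite nc0 r0 AP0 gt_eqF.
Qed.
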